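(* Let $f, g \colon \mathbb{R}^n \to \mathbb{R}^n$ be polynomial maps, and let $\mathfrak{m}(x) := \min\{f(x), g(x)\}$ (componentwise minimum). The following conditions are equivalent: (i) The set $\mathrm{SOL}(f, g)$ is compact (possibly empty). (ii) There exist constants $c > 0$, $R > 0$, and $\alpha \in \mathbb{Q}$ such that $\|\mathfrak{m}(x)\| \ge c \|x\|^\alpha$ for all $x\in\mathbb{R}^n$ with $\|x\| \ge R$.
   Context: For polynomial maps $f,g\colon\mathbb{R}^n\to\mathbb{R}^n$, $\mathrm{SOL}(f,g):=\{x\in\mathbb{R}^n : f(x)\ge 0,\ g(x)\ge 0,\ \langle f(x),g(x)\rangle=0\}$, with vector inequalities componentwise. Equivalently, $\mathrm{SOL}(f,g)$ is the zero set of $\mathfrak{m}$. $\|\cdot\|$ is the Euclidean norm. *)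

(* Defs.v *)
From mathcomp Require Import all_boot all_order all_algebra.
From mathcomp Require Import all_classical all_reals all_analysis.
(* not imported: its notations clash with those of mathcomp-analysis *)
From mathcomp.multinomials Require mpoly.

Set Implicit Arguments.
Unset Strict Implicit.
Unset Printing Implicit Defensive.

Import Order.TTheory GRing.Theory Num.Theory.
Import numFieldNormedType.Exports.

Local Open Scope classical_set_scope.
Local Open Scope ring_scope.

Section Definitions.
Variables (R : realType) (n : nat).
Implicit Types (x y : 'rV[R]_n) (f g : 'rV[R]_n -> 'rV[R]_n).

Definition polynomial_map f : Prop :=
  exists p : 'I_n -> mpoly.mpoly n R,
    forall x i, f x 0 i = mpoly.meval (fun j => x 0 j) (p i).

Definition inner x y : R := \sum_(i < n) x 0 i * y 0 i.

(* The library norm `|x| on 'rV[R]_n is the sup norm; it induces the same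
   topology as this one. *)
Definition enorm x : R := Num.sqrt (inner x x).

Definition vec_nonneg x : Prop := forall i, 0 <= x 0 i.

Definition SOL f g : set 'rV[R]_n :=
  [set x | [/\ vec_nonneg (f x), vec_nonneg (g x) & inner (f x) (g x) = 0]].

Definition min_map f g x : 'rV[R]_n :=
  \row_(i < n) Num.min (f x 0 i) (g x 0 i).

End Definitions.

(* Main.v *)
Require Import Defs.
From mathcomp Require Import all_boot all_order all_algebra.
From mathcomp Require Import all_classical all_reals all_analysis.
From mathcomp Require Import lra polyrcf ordered_qelim qe_rcf.
From mathcomp.multinomials Require mpoly.
Import Order.TTheory GRing.Theory Num.Theory.
Import numFieldNormedType.Exports.
Local Open Scope classical_set_scope.
Local Open Scope ring_scope.

(** Write [m] for the componentwise minimum of [f] and [g]; [SOL f g] is the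
    zero set of the continuous map [m].

    If the norm of [m] is at least [c * enorm x `^ alpha] outside a ball, then
    [m] does not vanish there, so [SOL f g] is closed and bounded
    ([compact_SOL_of_growth]).

    For the converse, consider the semialgebraic subset of the plane
      [D = {(t, a) | some x with |x|^2 = t has |m_i x| <= a for all i}].
    The key fact ([cusp_formula]) is that a semialgebraic subset of the plane
    cannot oscillate near [t = +oo, a = 0+]: for some [N] it contains, or is
    disjoint from, the whole cusp [{(t, a) | N + 1 <= t, 0 < a <= t ^- N}].
    By quantifier elimination over real closed fields ([formula_qf]) this
    reduces to polynomial sign conditions.  The sign of a polynomial
    [P(t, a)] on a thin cusp is that of the leading coefficient of its first
    nonzero coefficient [c(t)] as a polynomial in [a]: after division by a
    power of [a > 0], [|c(t)|] is bounded below for large [t], while the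
    remaining terms are at most [a * t ^+ M] ([cusp_poly2_sign]).

    If [SOL f g] is compact, every large sphere [|x|^2 = t] avoids it, so by
    compactness [(t, a)] is not in [D] for [a] small enough, depending on [t]
    ([sphere_residual_gt0]).  Hence [D] does not contain a cusp, so it is
    disjoint from one, and at [a = t ^- N] this says that the norm of [m x]
    exceeds [|x| ^- (2 * N)] for all large [x] ([growth_of_compact_SOL]). *)

Set Implicit Arguments.
Unset Strict Implicit.

(** * Signs of polynomials on thin cusps *)

Section Cusp.
Variable R : realType.
Implicit Types (t a : R) (N : nat) (Q : R -> R -> Prop).

(** The threshold [N.+1] on [t] grows with [N] and is at least [1], which makes
    the cusps a decreasing sequence and lets them absorb any constant: the
    properties holding on some cusp are closed under finite conjunction. *)
Definition cusp N t a := [/\ N.+1%:R <= t, 0 < a & a * t ^+ N <= 1].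

Definition cusp_near Q := exists N, forall t a, cusp N t a -> Q t a.

Lemma cusp_ge1 N t a : cusp N t a -> 1 <= t.
Proof. by case=> Nt _ _; apply: le_trans Nt; rewrite ler1n. Qed.

Lemma cusp_le1 N t a : cusp N t a -> a <= 1.
Proof.
move=> c; have t1 := cusp_ge1 c; case: c => _ a0 /(le_trans _); apply.
by rewrite ler_peMr ?exprn_ege1 // ltW.
Qed.

Lemma cuspW M N t a : (M <= N)%N -> cusp N t a -> cusp M t a.
Proof.
move=> MN c; have t1 := cusp_ge1 c; case: c => Nt a0 aN; split => //.
  by apply: le_trans Nt; rewrite ler_nat ltnS.
by apply: le_trans aN; rewrite ler_pM2l // ler_weXn2l.
Qed.

Lemma cusp_near_and P Q :
  cusp_near P -> cusp_near Q -> cusp_near (fun t a => P t a /\ Q t a).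
Proof.
move=> [M hP] [N hQ]; exists (maxn M N) => t a c.
by split; [apply: hP|apply: hQ]; apply: cuspW c; rewrite ?leq_maxl ?leq_maxr.
Qed.

Lemma cusp_near_mono P Q :
  (forall t a, P t a -> Q t a) -> cusp_near P -> cusp_near Q.
Proof. by move=> PQ [N hP]; exists N => t a /hP /PQ. Qed.

Lemma cusp_ge_const (B : R) : cusp_near (fun t _ => B <= t).
Proof.
exists (Num.truncn `|B|) => t a [+ _ _]; apply: le_trans.
by rewrite (le_trans (ler_norm B)) // ltW // truncnS_gt.
Qed.


(** Polynomial growth in [t] alone, since [a <= 1] on every cusp. *)
Definition cusp_moderate (u : R -> R -> R) :=
  exists M, cusp_near (fun t a => `|u t a| <= t ^+ M).

Lemma cusp_moderate_cst (c : R) : cusp_moderate (fun _ _ => c).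
Proof.
by exists 1; apply: cusp_near_mono (cusp_ge_const `|c|) => t a; rewrite expr1.
Qed.

Lemma cusp_moderateM u v : cusp_moderate u -> cusp_moderate v ->
  cusp_moderate (fun t a => u t a * v t a).
Proof.
move=> [M hu] [N hv]; exists (M + N)%N.
apply: cusp_near_mono (cusp_near_and hu hv) => t a [ut vt].
by rewrite normrM exprD ler_pM.
Qed.

Lemma cusp_moderateD u v : cusp_moderate u -> cusp_moderate v ->
  cusp_moderate (fun t a => u t a + v t a).
Proof.
move=> [M hu] [N hv]; exists (maxn M N).+1.
apply: cusp_near_mono (cusp_near_and (cusp_ge_const 2) (cusp_near_and hu hv)).
move=> t a [t2 [ut vt]]; apply: le_trans (ler_normD _ _) _.
have t1 : 1 <= t by lra.
have hM : t ^+ M <= t ^+ maxn M N by rewrite ler_weXn2l// leq_maxl.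
have hN : t ^+ N <= t ^+ maxn M N by rewrite ler_weXn2l// leq_maxr.
have h0 : 0 <= t ^+ maxn M N by rewrite exprn_ge0// (le_trans _ t1).
by rewrite exprS; nra.
Qed.

Lemma cusp_moderate_poly (p : {poly R}) : cusp_moderate (fun t _ => p.[t]).
Proof.
elim/poly_ind: p => [|p c IH].
  have [M h] := cusp_moderate_cst 0.
  by exists M; apply: cusp_near_mono h => t a; rewrite horner0.
have ht : cusp_moderate (fun t _ => t).
  exists 1, 0 => t a /cusp_ge1 t1.
  by rewrite expr1 ger0_norm// (le_trans _ t1).
have [M h] := cusp_moderateD (cusp_moderateM IH ht) (cusp_moderate_cst c).
by exists M; apply: cusp_near_mono h => t a; rewrite !hornerE.
Qed.

Lemma cusp_moderate_poly2 (P : {poly {poly R}}) :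
  cusp_moderate (fun t a => P.[a%:P].[t]).
Proof.
elim/poly_ind: P => [|P c IH].
  have [M h] := cusp_moderate_cst 0.
  by exists M; apply: cusp_near_mono h => t a; rewrite !horner0.
have ha : cusp_moderate (fun _ a => a).
  exists 0, 0 => t a c0; rewrite expr0 ger0_norm ?(cusp_le1 c0)//.
  by case: c0 => _ /ltW.
have [M h] :=
  cusp_moderateD (cusp_moderateM IH ha) (cusp_moderate_poly c).
by exists M; apply: cusp_near_mono h => t a; rewrite !hornerE.
Qed.

(** A further factor [a <= t ^- M.+1] beats the growth [t ^+ M], leaving
    [t ^- 1]. *)
Lemma cusp_moderate_small u (d : R) : 0 < d -> cusp_moderate u ->
  cusp_near (fun t a => `|u t a * a| < d).
Proof.
move=> d0 [M hu].
have hM : cusp_near (cusp M.+1) by exists M.+1.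
apply: cusp_near_mono
  (cusp_near_and hu (cusp_near_and hM (cusp_ge_const (d^-1 + 1)))).
move=> t a [ut [[_ a0 aM] td]].
have di0 : 0 < d^-1 by rewrite invr_gt0.
have t0 : 0 < t by lra.
rewrite normrM (gtr0_norm a0) -(ltr_pM2r t0).
apply: (@le_lt_trans _ _ 1).
  apply: le_trans aM; rewrite exprSr mulrA ler_wpM2r ?(ltW t0)//.
  by rewrite mulrC ler_wpM2l// ltW.
by rewrite mulrC -ltr_pdivrMr// mul1r; lra.
Qed.

(** Beyond its largest root a polynomial has the sign of its leading
    coefficient, and stays away from [0]. *)
Lemma cusp_poly_sign (p : {poly R}) : p != 0 ->
  exists2 d, 0 < d & exists b : bool,
    cusp_near (fun t _ => d <= (-1) ^+ b * p.[t]).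
Proof.
move=> p0; exists `|lead_coef p|; first by rewrite normr_gt0 lead_coef_eq0.
exists (lead_coef p < 0)%R.
set q := (-1) ^+ (lead_coef p < 0)%R *: p.
have qE : lead_coef q = `|lead_coef p|.
  by rewrite lead_coefZ normrEsign.
have [|B hB] := @poly_pinfty_gt_lc _ q.
  by rewrite qE normr_gt0 lead_coef_eq0.
apply: cusp_near_mono (cusp_ge_const B) => t _ /hB.
by rewrite qE hornerZ.
Qed.

(** In [P * 'X + c] the coefficient [c], when nonzero, dominates [P(t, a) * a]
    by [cusp_moderate_small]; when [c = 0] the factor [a > 0] does not affect
    the sign and the argument continues with [P]. *)
Lemma cusp_poly2_sign (P : {poly {poly R}}) :
  exists s, cusp_near (fun t a => Num.sg P.[a%:P].[t] = s).
Proof.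
elim/poly_ind: P => [|P c [s hs]].
  by exists 0, 0 => t a _; rewrite !horner0 sgr0.
have [->|c0] := eqVneq c 0.
  exists s.
  have pos : cusp_near (fun _ a => 0 < a) by exists 0 => t a [].
  apply: cusp_near_mono (cusp_near_and hs pos) => t a [<- a0].
  by rewrite !hornerE sgrM (gtr0_sg a0) mulr1.
have [d d0 [b hb]] := cusp_poly_sign c0.
exists ((-1) ^+ b).
apply: cusp_near_mono
  (cusp_near_and hb (cusp_moderate_small d0 (cusp_moderate_poly2 P))).
move=> t a [bc Pa]; rewrite !hornerE.
set x := _ * a in Pa *.
have pos : 0 < (-1) ^+ b * (x + c.[t]).
  rewrite mulrDr; move: Pa; rewrite -(normrMsign b).
  by rewrite ltr_norml => /andP[]; lra.
move: (gtr0_sg pos); rewrite sgrM.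
by case: (b); rewrite ?expr0 ?expr1 ?sgrN sgr1 => ?; lra.
Qed.

(** The environment [[:: t; a]] gives the value [0] to the variables of index
    at least [2]. *)
Lemma rterm_poly2 (u : GRing.term R) : GRing.rterm u ->
  exists P : {poly {poly R}},
    forall t a, GRing.eval [:: t; a] u = P.[a%:P].[t].
Proof.
elim: u => //=.
- case=> [|[|k]] _; [exists ('X%:P)|exists 'X|exists 0] => t a /=.
  + by rewrite hornerC hornerX.
  + by rewrite hornerX hornerC.
  + by rewrite nth_nil !horner0.
- by move=> c _; exists c%:P%:P => t a; rewrite !hornerC.
- by move=> k _; exists k%:R => t a; rewrite -!polyC_natr !hornerC.
- move=> u IHu v IHv /andP[/IHu[P hP] /IHv[Q hQ]].
  by exists (P + Q) => t a; rewrite hP hQ !hornerE.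
- by move=> u IHu /IHu[P hP]; exists (- P) => t a; rewrite hP !hornerE.
- move=> u IHu k /IHu[P hP]; exists (P *+ k) => t a.
  by rewrite hP !hornerMn.
- move=> u IHu v IHv /andP[/IHu[P hP] /IHv[Q hQ]].
  by exists (P * Q) => t a; rewrite hP hQ !hornerE.
- move=> u IHu k /IHu[P hP]; exists (P ^+ k) => t a.
  by rewrite hP !horner_exp.
Qed.

Lemma cusp_qf_formula (F : ord.formula R) : ord.qf_form F -> ord.rformula F ->
  exists b, cusp_near (fun t a => ord.qf_eval [:: t; a] F = b).
Proof.
have diff (u v : GRing.term R) : GRing.rterm u && GRing.rterm v ->
    exists s, cusp_near (fun t a =>
      Num.sg (GRing.eval [:: t; a] u - GRing.eval [:: t; a] v) = s).
  case/andP => /rterm_poly2[P hP] /rterm_poly2[Q hQ].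
  have [s hs] := cusp_poly2_sign (P - Q); exists s.
  by apply: cusp_near_mono hs => t a; rewrite hP hQ !hornerE.
have conn (op : bool -> bool -> bool) F1 F2 :
    (exists b, cusp_near (fun t a => ord.qf_eval [:: t; a] F1 = b)) ->
    (exists b, cusp_near (fun t a => ord.qf_eval [:: t; a] F2 = b)) ->
    exists b, cusp_near (fun t a =>
      op (ord.qf_eval [:: t; a] F1) (ord.qf_eval [:: t; a] F2) = b).
  move=> [b1 h1] [b2 h2]; exists (op b1 b2).
  by apply: cusp_near_mono (cusp_near_and h1 h2) => t a [-> ->].
elim: F => //=.
- by move=> b _ _; exists b, 0.
- move=> u v _ /diff[s hs]; exists (s == 0).
  by apply: cusp_near_mono hs => t a <-; rewrite sgr_eq0 subr_eq0.
- move=> u v _ /diff[s hs]; exists (s < 0)%R.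
  by apply: cusp_near_mono hs => t a <-; rewrite sgr_lt0 subr_lt0.
- move=> u v _ /diff[s hs]; exists (s <= 0)%R.
  by apply: cusp_near_mono hs => t a <-; rewrite sgr_le0 subr_le0.
- move=> F1 IH1 F2 IH2 /andP[q1 q2] /andP[r1 r2].
  exact: (conn andb F1 F2 (IH1 q1 r1) (IH2 q2 r2)).
- move=> F1 IH1 F2 IH2 /andP[q1 q2] /andP[r1 r2].
  exact: (conn orb F1 F2 (IH1 q1 r1) (IH2 q2 r2)).
- move=> F1 IH1 F2 IH2 /andP[q1 q2] /andP[r1 r2].
  exact: (conn implb F1 F2 (IH1 q1 r1) (IH2 q2 r2)).
- move=> F IH q r; have [b hb] := IH q r; exists (~~ b).
  by apply: cusp_near_mono hb => t a ->.
Qed.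

(** The formula is first made free of inverses, so that the atoms of the result
    are comparisons of polynomials. *)
Lemma formula_qf (F : ord.formula R) : exists G : ord.formula R,
  [/\ ord.qf_form G, ord.rformula G &
      forall e, ord.qf_eval e G <-> ord.holds e F].
Proof.
pose proj := ord.proj (fun n bc => qfr_to_formula (@wproj R n bc)).
exists (ord.quantifier_elim
  (fun n bc => qfr_to_formula (@wproj R n bc)) (ord.to_rform F)).
have /andP[qG rG] := ord.quantifier_elim_wf (@wf_QE_wproj R)
  (ord.to_rform_rformula F).
split=> // e; split => /(ord.proj_satP (@wf_QE_wproj R) (@valid_QE_wproj R)) //.
Qed.

(** A local form of o-minimality, at the corner [t = +oo, a = 0+] of the plane. *)
Lemma cusp_formula (F : ord.formula R) :
  exists b : bool, cusp_near (fun t a => ord.holds [:: t; a] F <-> b).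
Proof.
have [G [qG rG GF]] := formula_qf F.
have [b hb] := cusp_qf_formula qG rG; exists b.
by apply: cusp_near_mono hb => t a <-; split=> /GF.
Qed.
End Cusp.

(** * Definable functions and predicates of finitely many real variables *)

Section Definable.
Variable R : realType.
Implicit Types (e s : seq R) (u v d : seq R -> R) (A B : seq R -> Prop).

Definition term_fun d := exists u : GRing.term R, forall e, GRing.eval e u = d e.

Lemma term_fun_cst (c : R) : term_fun (fun _ => c).
Proof. by exists (GRing.Const c). Qed.

Lemma term_fun_var k : term_fun (fun e => e`_k).
Proof. by exists (GRing.Var R k). Qed.

Lemma term_funN u : term_fun u -> term_fun (fun e => - u e).
Proof. by move=> [t ht]; exists (GRing.Opp t) => e /=; rewrite ht. Qed.

Lemma term_funD u v : term_fun u -> term_fun v -> term_fun (fun e => u e + v e).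
Proof.
by move=> [t ht] [r hr]; exists (GRing.Add t r) => e /=; rewrite ht hr.
Qed.

Lemma term_funM u v : term_fun u -> term_fun v -> term_fun (fun e => u e * v e).
Proof.
by move=> [t ht] [r hr]; exists (GRing.Mul t r) => e /=; rewrite ht hr.
Qed.

Lemma term_funX u k : term_fun u -> term_fun (fun e => u e ^+ k).
Proof. by move=> [t ht]; exists (GRing.Exp t k) => e /=; rewrite ht. Qed.

Lemma term_fun_big (op : R -> R -> R) (x0 : R) (I : Type) (r : seq I)
    (F : I -> seq R -> R) :
  (forall u v, term_fun u -> term_fun v -> term_fun (fun e => op (u e) (v e))) ->
  (forall i, term_fun (F i)) ->
  term_fun (fun e => \big[op/x0]_(i <- r) F i e).
Proof.
move=> hop hF; elim: r => [|i r [t ht]].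
  by exists (GRing.Const x0) => e; rewrite big_nil.
by have [w hw] := hop _ _ (hF i) (ex_intro _ t ht); exists w => e; rewrite big_cons.
Qed.

Lemma term_fun_meval n (p : mpoly.mpoly n R) k :
  term_fun (fun e => mpoly.meval (fun j : 'I_n => e`_(k + j)) p).
Proof.
have [t ht] : term_fun (fun e => \sum_(m <- mpoly.msupp p)
    mpoly.mcoeff m p * \prod_(i < n) e`_(k + i) ^+ (mpoly.fun_of_multinom m i)).
  apply: term_fun_big => [|m]; first exact: term_funD.
  apply: term_funM; first exact: term_fun_cst.
  apply: term_fun_big => [|i]; first exact: term_funM.
  exact/term_funX/term_fun_var.
by exists t => e; rewrite ht mpoly.mevalE.
Qed.

(** Only environments of length [m] matter, so that an existential quantifier
    over the variable of index [m] appends its witness to the environment. *)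
Definition definable m A :=
  exists F : ord.formula R, forall e, size e = m -> (ord.holds e F <-> A e).

Lemma definable_le m u v : term_fun u -> term_fun v ->
  definable m (fun e => u e <= v e).
Proof. by move=> [t ht] [r hr]; exists (ord.Le t r) => e _ /=; rewrite ht hr. Qed.

Lemma definable_eq m u v : term_fun u -> term_fun v ->
  definable m (fun e => u e = v e).
Proof.
by move=> [t ht] [r hr]; exists (ord.Equal t r) => e _ /=; rewrite ht hr.
Qed.

Lemma definable_and m A B : definable m A -> definable m B ->
  definable m (fun e => A e /\ B e).
Proof.
move=> [F hF] [G hG]; exists (ord.And F G) => e me /=.
by have [? ?] := hF e me; have [? ?] := hG e me; tauto.
Qed.

Lemma definable_or m A B : definable m A -> definable m B ->
  definable m (fun e => A e \/ B e).
Proof.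
move=> [F hF] [G hG]; exists (ord.Or F G) => e me /=.
by have [? ?] := hF e me; have [? ?] := hG e me; tauto.
Qed.

Lemma definable_forall m (I : finType) (C : I -> seq R -> Prop) :
  (forall i, definable m (C i)) -> definable m (fun e => forall i, C i e).
Proof.
move=> hC.
suff [F hF] : definable m (fun e => forall i, i \in enum I -> C i e).
  exists F => e me; split=> [/hF h i|h]; first by apply: h; rewrite // mem_enum.
  by apply/hF.
elim: (enum I) => [|i s IH]; first by exists (ord.Bool true) => e _; split.
have [F hF] := definable_and (hC i) IH; exists F => e me.
split=> [/hF -/(_ me)[h1 h2] j|h].
  by rewrite inE => /predU1P[->//|/h2].
by apply/hF => //; split=> [|j js]; apply: h; rewrite inE ?eqxx// js orbT.
Qed.

Lemma definable_ex_seq m n A : definable (m + n) A ->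
  definable m (fun e => exists2 s, size s = n & A (e ++ s)).
Proof.
move=> [F hF]; elim: n m => [|n IH] m in F hF *.
  exists F => e me; split=> [|[s /size0nil-> +]].
    by move/hF; rewrite addn0 => /(_ me) Ae; exists [::]; rewrite ?cats0.
  by rewrite cats0 => Ae; apply/hF; rewrite ?addn0.
rewrite addnS -addSn in hF.
have [G hG] := IH _ _ hF; exists (ord.Exists m G) => e me /=.
have setE x : set_nth 0 e m x = rcons e x by rewrite -me set_nthE ltnn subnn cats1.
split=> [[x]|[[//|x s] [sn] As]].
  rewrite setE => /hG; rewrite size_rcons me => /(_ erefl)[s sn].
  by rewrite cat_rcons => As; exists (x :: s) => //=; rewrite sn.
exists x; rewrite setE; apply/hG; first by rewrite size_rcons me.
by exists s; rewrite // cat_rcons.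
Qed.

Lemma definable_ex_rV m n (A : seq R -> 'rV[R]_n -> Prop) :
  definable (m + n) (fun e => A (take m e) (\row_i e`_(m + i))) ->
  definable m (fun e => exists x, A e x).
Proof.
move=> /definable_ex_seq[F hF]; exists F => e me.
have rowE s : \row_(i < n) (e ++ s)`_(m + i) = \row_i s`_i.
  by apply/rowP => i; rewrite !mxE nth_cat me ltnNge leq_addr addKn.
split=> [/hF -/(_ me)[s sn]|[x Ax]].
  by rewrite take_size_cat// => As; eexists; exact: As.
apply/hF => //; exists [seq x 0 i | i <- enum 'I_n].
  by rewrite size_map size_enum_ord.
rewrite take_size_cat// rowE.
rewrite [X in A e X](_ : _ = x)//; apply/rowP => i; rewrite mxE.
by rewrite (nth_map i) ?nth_ord_enum// size_enum_ord.
Qed.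

End Definable.

(** * The minimum map, its zero set and its sublevel sets *)

Section Residual.
Variables (R : realType) (n : nat).
Implicit Types (x y : 'rV[R]_n) (f g : 'rV[R]_n -> 'rV[R]_n).

Lemma inner_ge0 x : 0 <= inner x x.
Proof. by apply: sumr_ge0 => i _; rewrite -expr2 sqr_ge0. Qed.

Lemma enorm_sqr x : enorm x ^+ 2 = inner x x.
Proof. by rewrite sqr_sqrtr// inner_ge0. Qed.

Lemma coord_le_enorm x i : `|x 0 i| <= enorm x.
Proof.
rewrite -sqrtr_sqr ler_wsqrtr// expr2 /inner (bigD1 i)//= lerDl.
by apply: sumr_ge0 => j _; rewrite -expr2 sqr_ge0.
Qed.

Lemma inner_le_coord x a : (forall i, `|x 0 i| <= a) ->
  inner x x <= n%:R * a ^+ 2.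
Proof.
move=> xa; rewrite /inner.
have -> : n%:R * a ^+ 2 = \sum_(i < n) a ^+ 2.
  by rewrite sumr_const card_ord mulr_natl.
apply: ler_sum => i _; rewrite -expr2 -real_normK ?num_real//.
by rewrite lerXn2r ?nnegrE// (le_trans _ (xa i)).
Qed.

Lemma inner_eq0 x : inner x x = 0 <-> forall i, x 0 i = 0.
Proof.
split=> [/eqP|x0]; last by apply: big1 => i _; rewrite x0 mul0r.
rewrite psumr_eq0 => [|i _]; last by rewrite -expr2 sqr_ge0.
by move=> /allP h i; have /(_ (mem_index_enum i)) := h i;
  rewrite -expr2 sqrf_eq0 => /eqP.
Qed.

Lemma mx_norm_le_enorm x : `|x| <= enorm x.
Proof.
have [->|x0] := eqVneq `|x| 0; first exact: sqrtr_ge0.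
have [[j i]] := mx_norm_neq0 x0; rewrite ord1 /= => E.
by rewrite [leLHS]E coord_le_enorm.
Qed.

Lemma coord_le_mx_norm x i : `|x 0 i| <= `|x|.
Proof.
rewrite [leRHS]/Num.norm/= mx_normrE.
exact: (le_bigmax _ (fun ij : 'I_1 * 'I_n => `|x ij.1 ij.2|) (0, i)).
Qed.

Lemma SOL_min_map f g x : SOL f g x <-> inner (min_map f g x) (min_map f g x) = 0.
Proof.
rewrite inner_eq0; split=> [[f0 g0 fg] i|m0].
  have fgi : f x 0 i * g x 0 i = 0.
    move/eqP: fg; rewrite psumr_eq0 => [|j _]; last exact: mulr_ge0.
    by move=> /allP /(_ i (mem_index_enum i)) /eqP.
  rewrite mxE; have := f0 i; have := g0 i.
  move/eqP: fgi; rewrite mulf_eq0 => /orP[]/eqP-> ? ?.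
    by rewrite min_l.
  by rewrite min_r.
have mi i : [/\ 0 <= f x 0 i, 0 <= g x 0 i & f x 0 i * g x 0 i = 0].
  move: (m0 i); rewrite mxE /Num.min; case: ltP => [fg f0|gf g0].
    by rewrite f0 mul0r; split=> //; rewrite -f0 ltW.
  by rewrite g0 mulr0; split=> //; rewrite -g0.
by split=> [i|i|]; [case: (mi i)|case: (mi i)|apply: big1 => i _; case: (mi i)].
Qed.

Lemma continuous_sum (T : topologicalType) (I : Type) (r : seq I)
    (F : I -> T -> R) :
  (forall i, continuous (F i)) -> continuous (fun z => \sum_(i <- r) F i z).
Proof.
move=> cF; have cadd : continuous (fun z : R * R => z.1 + z.2).
  exact: (@add_continuous R^o).
exact: (continuous_big cadd).
Qed.

Lemma continuous_mul (T : topologicalType) (u v : T -> R) :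
  continuous u -> continuous v -> continuous (fun z => u z * v z).
Proof. by move=> cu cv z; apply: cvgM; [exact: cu|exact: cv]. Qed.

Lemma continuous_meval (p : mpoly.mpoly n R) :
  continuous (fun x => mpoly.meval (fun j => x 0 j) p).
Proof.
under [X in continuous X]eq_fun do rewrite mpoly.mevalE.
apply: continuous_sum => m.
apply: continuous_mul; first exact: cst_continuous.
apply: (continuous_big (@mul_continuous R)) => i _.
move=> x; apply: (@continuous_comp _ _ _ (fun x => x 0 i)
  (fun y : R => y ^+ mpoly.fun_of_multinom m i)); first exact: coord_continuous.
exact: exprn_continuous.
Qed.

Lemma continuous_inner (u : 'rV[R]_n -> 'rV[R]_n) :
  (forall i, continuous (fun x => u x 0 i)) ->
  continuous (fun x => inner (u x) (u x)).
Proof.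
move=> cu; apply: continuous_sum => i.
exact: continuous_mul.
Qed.

Lemma continuous_inner_min_map f g : polynomial_map f -> polynomial_map g ->
  continuous (fun x => inner (min_map f g x) (min_map f g x)).
Proof.
move=> [p hp] [q hq]; apply: continuous_inner => i.
under [X in continuous X]eq_fun do rewrite mxE hp hq.
by move=> x; apply: continuous_min; exact: continuous_meval.
Qed.

Lemma closed_level (h : 'rV[R]_n -> R) t :
  continuous h -> closed [set x | h x = t].
Proof.
move=> ch; apply: (@preimage_closed _ _ h [set t]) => //.
Qed.

Lemma compact_sphere t : compact [set x : 'rV[R]_n | inner x x = t].
Proof.
apply: bounded_closed_compact; last first.
  apply: closed_level; apply: continuous_inner => i; exact: coord_continuous.
exists (Num.sqrt t); split; first exact: num_real.
move=> y ty x /= xt; apply: le_trans (mx_norm_le_enorm x) _.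
by rewrite /enorm xt ltW.
Qed.

(** The sup norm of the residual avoids naming the values of the minimum:
    [|min y z| <= a] is a Boolean combination of comparisons of [y] and [z]
    with [a] and [- a]. *)
Lemma definable_small_residual f g : polynomial_map f -> polynomial_map g ->
  definable 2 (fun e => exists x, inner x x = e`_0 /\
    forall i, `|min_map f g x 0 i| <= e`_1).
Proof.
move=> [p hp] [q hq].
have minE x i a : `|min_map f g x 0 i| <= a <->
    (- a <= f x 0 i /\ - a <= g x 0 i) /\ (f x 0 i <= a \/ g x 0 i <= a).
  rewrite mxE ler_norml le_min ge_min; split.
    by move=> /andP[/andP[-> ->] /orP].
  by move=> [[-> ->] /orP].
pose small e (y z : R) := (- e`_1 <= y /\ - e`_1 <= z) /\ (y <= e`_1 \/ z <= e`_1).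
pose A e x := inner x x = e`_0 /\ forall i, small e (f x 0 i) (g x 0 i).
suff [F hF] : definable 2 (fun e => exists x, A e x).
  exists F => e me; split=> [/hF -/(_ me)[x [xt h]]|[x [xt h]]].
    by exists x; split=> // i; apply/minE; exact: h.
  by apply/hF => //; exists x; split=> // i; apply/minE.
apply: definable_ex_rV.
pose val (r : mpoly.mpoly n R) e := mpoly.meval (fun j : 'I_n => e`_(2 + j)) r.
have valE r e : mpoly.meval (fun j => (\row_(i < n) e`_(2 + i)) 0 j) r = val r e.
  by apply: mpoly.meval_eq => j; rewrite mxE.
pose Aval e := \sum_(i < n) e`_(2 + i) * e`_(2 + i) = e`_0 /\
  forall i, small e (val (p i) e) (val (q i) e).
have [F hF] : definable (2 + n) Aval.
  have hv := term_fun_var R; have hN := term_funN (hv 1%N).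
  have hm r : term_fun (val r) := term_fun_meval r 2.
  apply: definable_and.
    apply: definable_eq => //; apply: term_fun_big; first exact: term_funD.
    by move=> i; exact: term_funM.
  apply: definable_forall => i; apply: definable_and.
    by apply: definable_and; exact: definable_le.
  by apply: definable_or; exact: definable_le.
have eqA e : A (take 2 e) (\row_i e`_(2 + i)) <-> Aval e.
  rewrite /A /Aval /small /inner !nth_take//.
  under eq_bigr do rewrite mxE.
  by split=> -[h1 h2]; split=> // i; have := h2 i; rewrite hp hq !valE.
by exists F => e me; split=> [/hF/eqA|/eqA h]; [exact|exact/hF].
Qed.

End Residual.

(** * Compactness of the solution set and growth of the residual *)

Section Equivalence.
Variables (R : realType) (n : nat) (f g : 'rV[R]_n -> 'rV[R]_n).
Hypotheses (hf : polynomial_map f) (hg : polynomial_map g).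
Let m := min_map f g.

Lemma compact_SOL_of_growth (c rho : R) (alpha : R) : 0 < c -> 0 < rho ->
  (forall x, rho <= enorm x -> c * (enorm x `^ alpha) <= enorm (m x)) ->
  compact (SOL f g).
Proof.
move=> c0 rho0 h; apply: bounded_closed_compact; last first.
  have -> : SOL f g = [set x | inner (m x) (m x) = 0].
    by apply/seteqP; split=> x /=; rewrite SOL_min_map.
  exact/closed_level/continuous_inner_min_map.
exists rho; split; first exact: num_real.
move=> y rhoy x /SOL_min_map mx0; apply: le_trans (mx_norm_le_enorm x) _.
apply: le_trans (ltW rhoy); rewrite leNgt; apply/negP => /ltW xrho.
have := h x xrho; rewrite [leRHS]/enorm mx0 sqrtr0 leNgt.
by rewrite mulr_gt0// powR_gt0// (lt_le_trans rho0).
Qed.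

(** On the compact sphere the squared norm [h] of [m] has a positive minimum;
    since [h <= n * a ^+ 2 <= n * a] when all [|m_i| <= a <= 1], any [a] below
    that minimum divided by [n.+1] will do. *)
Lemma sphere_residual_gt0 (t : R) :
  (forall x, inner x x = t -> ~ SOL f g x) ->
  exists2 a0, 0 < a0 & forall a, 0 < a -> a < a0 ->
    ~ exists x, inner x x = t /\ forall i, `|m x 0 i| <= a.
Proof.
move=> tSOL.
have [[x0 x0t]|S0] := pselect (exists x : 'rV[R]_n, inner x x = t); last first.
  by exists 1 => // a _ _ [x [xt _]]; apply: S0; exists x.
have [|c] := @EVT_min_rV R n (fun x => inner (m x) (m x)) _ (ex_intro _ x0 x0t)
    (@compact_sphere R n t).
  exact/continuous_subspaceT/continuous_inner_min_map.
rewrite inE /= => ct cmin.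
have c0 : 0 < inner (m c) (m c).
  rewrite lt_neqAle inner_ge0 andbT eq_sym; apply/eqP => /SOL_min_map.
  exact: tSOL.
have n0 : 0 <= n%:R :> R by [].
set h := inner (m c) (m c) in c0 cmin *.
exists (Num.min 1 (h / n.+1%:R)) => [|a a0]; first by rewrite lt_min ltr01 divr_gt0.
rewrite lt_min ltr_pdivlMr// -natr1 => /andP[a1 ah] [x [xt xa]].
have := cmin x; rewrite inE /= => /(_ xt); rewrite leNgt => /negP; apply.
by apply: le_lt_trans (inner_le_coord xa) _; nra.
Qed.

(** The exponent [2 * N] comes from the parametrization of the spheres by the
    squared norm [t]. *)
Lemma growth_of_compact_SOL : compact (SOL f g) ->
  exists N : nat, exists2 rho : R, 0 < rho &
    forall x, rho <= enorm x -> enorm x ^- (2 * N) <= enorm (m x).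
Proof.
move=> /compact_bounded[K [_ hK]].
have {}hK x : SOL f g x -> inner x x <= n%:R * (`|K| + 1) ^+ 2.
  move=> Sx; apply: inner_le_coord => i; apply: le_trans (coord_le_mx_norm x i) _.
  by apply: hK Sx; rewrite (le_lt_trans (ler_norm K))// ltrDl.
set B := _ * _ in hK.
have B0 : 0 <= B by rewrite mulr_ge0// sqr_ge0.
have [F hF] := definable_small_residual hf hg.
have [b [N hN]] := cusp_formula F.
have N0 : 0 <= N%:R :> R by [].
exists N, (N.+1%:R + B + 1) => [|x]; rewrite -natr1; first by lra.
move=> xrho; set t := inner x x.
have t_ge : N%:R + 1 + B + 1 <= t by rewrite /t -enorm_sqr; nra.
have t0 : 0 < t by lra.
have tN : 0 < (t ^+ N)^-1 by rewrite invr_gt0 exprn_gt0.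
have in_cusp a : 0 < a -> a <= (t ^+ N)^-1 -> cusp N t a.
  move=> a0 aN; split=> //; first by rewrite -natr1; lra.
  by rewrite -ler_pdivlMr ?exprn_gt0// div1r.
(* the definable set misses the cusp: evaluate at the point (t, t ^- N) *)
case: b hN => hN; last first.
  have : ~ exists y, inner y y = t /\ forall i, `|m y 0 i| <= (t ^+ N)^-1.
    move=> /(hF [:: t; (t ^+ N)^-1] erefl) /hN H.
    by have := H (in_cusp _ tN (lexx _)).
  move=> hno; have [i mi] : exists i, (t ^+ N)^-1 < `|m x 0 i|.
    apply: contrapT => no; apply: hno; exists x; split=> // i.
    by rewrite leNgt; apply/negP => ?; apply: no; exists i.
  rewrite exprM enorm_sqr; apply: le_trans (ltW mi) _.
  exact: coord_le_enorm.
(* the definable set contains the cusp: positivity on the sphere excludes it *)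
have [|a0 a0_gt0 ha] := @sphere_residual_gt0 t.
  by move=> y yt /hK; rewrite yt; lra.
pose a := Num.min (t ^+ N)^-1 (a0 / 2).
have a_gt0 : 0 < a by rewrite lt_min tN divr_gt0.
have a_lt : a < a0 by rewrite /a gt_min; apply/orP; right; lra.
case: (ha a a_gt0 a_lt); apply/(hF [:: t; a] erefl)/hN => //.
by apply: in_cusp => //; rewrite /a ge_min lexx.
Qed.
End Equivalence.
Unset Implicit Arguments.
Set Strict Implicit.

Theorem proposition4p1 (R : realType) (n : nat) (f g : 'rV[R]_n -> 'rV[R]_n)
    (hf : polynomial_map f) (hg : polynomial_map g) :
  compact (SOL f g) <->
  exists (c rho : R) (alpha : rat),
    [/\ 0 < c, 0 < rho &
        forall x : 'rV[R]_n, rho <= enorm x ->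
          c * (enorm x `^ ratr alpha) <= enorm (min_map f g x)].
Proof.
split=> [/(growth_of_compact_SOL hf hg)[N [rho rho0 h]]|].
  exists 1, rho, (- (2 * N)%:R); split=> // x /h.
  by rewrite mul1r rmorphN rmorph_nat powR_invn// sqrtr_ge0.
by move=> [c [rho [alpha [c0 rho0 h]]]]; exact: compact_SOL_of_growth h.
Qed.
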